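(* For integers $n,\ell$ with $-1\le\ell\le n-3$ let $i_0=i_0(n,\ell)=\lfloor\frac{n-1-\ell}{2}\rfloor$, and let $t\in\{1,2,\ldots,n-1\}$. (a) When $\ell=0$ and $n\ge 4$, $$s_t(G_n^{0}(1))\le s_t(G_n^{0}(i_0))\quad\text{for } t\ge\tfrac{n+1}{2},$$ $$s_t(G_n^{0}(i_0))\le s_t(G_n^{0}(1))\quad\text{for } t<\tfrac{n+1}{2},$$ and these inequalities are strict for $n\ge 6$. (b) For all $\ell$ with $-1\le\ell\le n-3$, if $t\ge\frac{n+\ell+1}{2}$, then $s_t(G_n^{\ell}(1))\le s_t(G_n^{\ell}(i_0))$, and the inequality is strict for $0\le\ell\le n-5$.
   Context: All graphs are finite and simple. $K_m$ is the complete graph and $I_m$ the edgeless graph on $m$ vertices; $\cup$ denotes disjoint union, and $A+B$ denotes the join (disjoint union of $A$ and $B$ together with all edges between them). For integers $n,i,\ell$ with $-1\le\ell\le n-3$ and $1\le i\le\frac{n-1-\ell}{2}$, define $G_n^{\ell}(i)=K_{i+\ell}+(I_i\cup K_{n-2i-\ell})$; when $i+\ell=0$ this is $I_1\cup K_{n-1}$. For $t\ge 1$, $s_t(G)$ is the number of $t$-stars (copies of $K_{1,t}$) in $G$: $s_t(G)=\sum_{v\in V(G)}\binom{d(v)}{t}$ for $t\ge 2$, and $s_1(G)=e(G)=\frac12\sum_{v}d(v)$. *)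

(* Defs.v *)
From mathcomp Require Import all_boot all_order all_algebra.
From mathcomp Require Import zify.

Set Implicit Arguments.
Unset Strict Implicit.
Unset Printing Implicit Defensive.

Import Order.TTheory GRing.Theory Num.Theory.

Record sgraph := SGraph {
  vertex :> finType;
  adj : rel vertex;
  adj_sym : symmetric adj;
  adj_irrefl : irreflexive adj }.

Section Constructions.

Definition complete_adj m : rel 'I_m := fun x y => x != y.
Lemma complete_sym m : symmetric (@complete_adj m).
Proof. by move=> x y; rewrite /complete_adj eq_sym. Qed.
Lemma complete_irrefl m : irreflexive (@complete_adj m).
Proof. by move=> x; rewrite /complete_adj eqxx. Qed.
Definition complete m : sgraph := SGraph (@complete_sym m) (@complete_irrefl m).

Definition edgeless_adj m : rel 'I_m := fun _ _ => false.
Lemma edgeless_sym m : symmetric (@edgeless_adj m).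
Proof. by []. Qed.
Lemma edgeless_irrefl m : irreflexive (@edgeless_adj m).
Proof. by []. Qed.
Definition edgeless m : sgraph := SGraph (@edgeless_sym m) (@edgeless_irrefl m).

Variables A B : sgraph.

Definition union_adj : rel (A + B)%type := fun x y =>
  match x, y with
  | inl a, inl a' => adj a a'
  | inr b, inr b' => adj b b'
  | _, _ => false
  end.
Lemma union_sym : symmetric union_adj.
Proof. by move=> [a|b] [a'|b'] //=; rewrite adj_sym. Qed.
Lemma union_irrefl : irreflexive union_adj.
Proof. by move=> [a|b] /=; rewrite adj_irrefl. Qed.
Definition gunion : sgraph := SGraph union_sym union_irrefl.

Definition join_adj : rel (A + B)%type := fun x y =>
  match x, y with
  | inl a, inl a' => adj a a'
  | inr b, inr b' => adj b b'
  | _, _ => true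
  end.
Lemma join_sym : symmetric join_adj.
Proof. by move=> [a|b] [a'|b'] //=; rewrite adj_sym. Qed.
Lemma join_irrefl : irreflexive join_adj.
Proof. by move=> [a|b] /=; rewrite adj_irrefl. Qed.
Definition gjoin : sgraph := SGraph join_sym join_irrefl.

End Constructions.

(* The order of each part is an integer expression that is nonnegative when
   -1 <= l <= n - 3 and 1 <= i <= (n - 1 - l) / 2; the absolute value is then
   only the conversion to nat.  When i + l = 0 the first part is K_0, and the
   graph is (isomorphic to) the disjoint union of I_1 and K_(n-1). *)
Definition Gnl (n : nat) (l : int) (i : nat) : sgraph :=
  gjoin (complete `|(i%:Z + l)%R|)
        (gunion (edgeless i) (complete `|(n%:Z - 2%:Z * i%:Z - l)%R|)).

(* floor ((n - 1 - l) / 2), nonnegative when l <= n - 3 *)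
Definition i0 (n : nat) (l : int) : nat := `|((n%:Z - 1 - l)%R %/ 2)%Z|%N.

Definition nbh (G : sgraph) (v : G) : {set G} := [set u | adj v u].
Definition deg (G : sgraph) (v : G) : nat := #|nbh v|.

Definition edges (G : sgraph) : {set {set G}} :=
  [set [set e.1; e.2] | e : G * G & adj e.1 e.2].

Definition embedding (H G : sgraph) (f : {ffun H -> G}) : bool :=
  injectiveb f && [forall x, forall y, adj x y ==> adj (f x) (f y)].

(* A subgraph is encoded as its vertex set together with its edge set. *)
Definition image_subgraph (H G : sgraph) (f : {ffun H -> G}) :
    {set G} * {set {set G}} :=
  ([set f x | x : H], [set [set f e.1; f e.2] | e : H * H & adj e.1 e.2]).

(* The (not necessarily induced) subgraphs of G isomorphic to H are exactly the
   images of the embeddings of H; each subgraph is counted once, whatever the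
   number of embeddings having it as image. *)
Definition copies (H G : sgraph) : {set {set G} * {set {set G}}} :=
  [set image_subgraph f | f : {ffun H -> G} & embedding f].

Definition star t : sgraph := gjoin (complete 1) (edgeless t).

Definition stars t (G : sgraph) : nat := #|copies (star t) G|.

Lemma card_Gnl (n : nat) (l : int) (i : nat) :
  (0 <= i%:Z + l -> l <= n%:Z - 2%:Z * i%:Z -> #|Gnl n l i| = n)%R.
Proof. by move=> h1 h2; rewrite /Gnl /= !card_sum !card_ord; lia. Qed.

Section StarCount.

Variable G : sgraph.
Implicit Types (v u : G) (S : {set G}).

Let complete1 (a : complete 1) : a = (ord0 : 'I_1).
Proof. exact: ord1. Qed.

Let starsub v S : {set G} * {set {set G}} :=
  (v |: S, [set [set v; u] | u in S]).

Let copies_starP t W :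
  reflect (exists v S, [/\ S \subset nbh v, #|S| = t & W = starsub v S])
          (W \in copies (star t) G).
Proof.
apply: (iffP imsetP) => [[f]|[v [S [sS cS ->]]]].
  rewrite inE => /andP[/injectiveP inj_f /forallP hom_f] ->.
  exists (f (inl ord0)), [set f (inr j) | j : edgeless t]; split.
  - apply/subsetP=> _ /imsetP[j _ ->]; rewrite inE.
    by move/forallP: (hom_f (inl ord0)) => /(_ (inr j)).
  - by rewrite card_imset ?card_ord // => i j /inj_f[].
  - congr (_, _).
      apply/setP=> x; rewrite !inE; apply/imsetP/orP=> [[[a|b] _ ->]|].
      - by left; rewrite (complete1 a).
      - by right; apply: imset_f.
      - by case=> [/eqP->|/imsetP[j _ ->]]; [exists (inl ord0)|exists (inr j)].
    apply/setP=> x; apply/imsetP/imsetP=> [[[[a|a] [b|b]]]|].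
    - by rewrite !inE /= /complete_adj (complete1 a) (complete1 b) eqxx.
    - by move=> _ /= ->; rewrite (complete1 a); exists (f (inr b)) => //; first exact: imset_f.
    - move=> _ /= ->; rewrite (complete1 b); exists (f (inr a)) => //; first exact: imset_f.
      by rewrite setUC.
    - by rewrite inE.
    - case=> _ /imsetP[j _ ->] ->.
      by exists (inl ord0, inr j) => //=; rewrite inE.
case: t / cS.
pose f : {ffun star #|S| -> G} :=
  [ffun x : 'I_1 + 'I_#|S| => if x is inr j then enum_val j else v].
have fl a : f (inl a) = v by rewrite ffunE.
have fr j : f (inr j) = enum_val j by rewrite ffunE.
have vE j : adj v (enum_val (j : 'I_#|S|)).
  by have /subsetP/(_ _ (enum_valP j)) := sS; rewrite inE.
exists f.
  rewrite inE; apply/andP; split.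
    apply/injectiveP=> -[a|a] [b|b]; rewrite ?fl ?fr.
    - by rewrite (complete1 a) (complete1 b).
    - by move=> e; have := vE b; rewrite -e adj_irrefl.
    - by move=> e; have := vE a; rewrite e adj_irrefl.
    - by move/enum_val_inj->.
  apply/forallP=> -[a|a]; apply/forallP=> -[b|b]; rewrite ?fl ?fr //=.
  - by rewrite /complete_adj (complete1 a) (complete1 b) eqxx.
  - by rewrite adj_sym.
congr (_, _).
  apply/setP=> x; rewrite !inE; apply/orP/imsetP=> [[/eqP->|xS]|[[a|b] _ ->]].
  - by exists (inl ord0); rewrite ?fl.
  - by exists (inr (enum_rank_in xS x)); rewrite ?fr ?enum_rankK_in.
  - by left; rewrite fl.
  - by right; rewrite fr enum_valP.
apply/setP=> x; apply/imsetP/imsetP=> [[u uS ->]|[[[a|a] [b|b]]]].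
- exists (inl ord0, inr (enum_rank_in uS u)); first by rewrite inE.
  by rewrite /= fl fr enum_rankK_in.
- by rewrite !inE /= /complete_adj (complete1 a) (complete1 b) eqxx.
- by move=> _ /= ->; exists (enum_val b); rewrite ?enum_valP // fl fr.
- by move=> _ /= ->; exists (enum_val a); rewrite ?enum_valP // fl fr setUC.
- by rewrite inE.
Qed.

Lemma stars_gt1 t : 1 < t -> stars t G = \sum_(v : G) 'C(deg v, t).
Proof.
move=> t1; pose D v : {set {set G}} := [set S : {set G} | S \subset nbh v & #|S| == t].
transitivity #|[set p : G * {set G} | p.2 \in D p.1]|.
  have -> : stars t G = #|[set starsub p.1 p.2 | p : G * {set G} & p.2 \in D p.1]|.
    congr #|pred_of_set _|; apply/setP=> W; apply/copies_starP/imsetP.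
      by case=> v [S [sS /eqP cS ->]]; exists (v, S) => //; rewrite !inE sS.
    by case=> -[v S] /=; rewrite !inE => /andP[sS /eqP cS] ->; exists v, S.
  apply: card_in_imset => -[v S] [v' S']; rewrite !inE /=.
  move=> /andP[sS /eqP cS] /andP[sS' /eqP cS'] [eV eE].
  have vS : v \notin S.
    by apply: contraL isT => /(subsetP sS); rewrite inE adj_irrefl.
  have vS' : v' \notin S'.
    by apply: contraL isT => /(subsetP sS'); rewrite inE adj_irrefl.
  have ev : v = v'.
    apply/eqP/negPn/negP=> nvv.
    have [u] : exists u, u \in S :\ v'.
      apply/set0Pn; rewrite -card_gt0.
      by have := cardsD1 v' S; case: (_ \in S); rewrite cS; lia.
    rewrite !inE => /andP[nuv uS].
    have : [set v; u] \in [set [set v; x] | x in S] by apply: imset_f.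
    rewrite eE => /imsetP[x _ /setP/(_ v')]; rewrite !inE eqxx /=.
    by rewrite eq_sym (negbTE nvv) eq_sym (negbTE nuv).
  move: eV; rewrite -ev in vS' * => eV; congr (_, _).
  by rewrite -(setU1K vS) eV setU1K.
rewrite -sum1_card (eq_bigl (fun p : G * {set G} => true && (p.2 \in D p.1)));
  last by move=> p; rewrite inE.
rewrite -(pair_big_dep xpredT (fun v S => S \in D v) (fun _ _ => 1)) /=.
by apply: eq_bigr => v _; rewrite sum1_card cards_draws.
Qed.

Lemma stars1 : stars 1 G = #|edges G|.
Proof.
have -> : stars 1 G = #|[set (e, [set e]) | e in edges G]|.
  congr #|pred_of_set _|; apply/setP=> W; apply/copies_starP/imsetP.
    case=> v [S [sS /eqP/cards1P[u eS] ->]]; rewrite {}eS in sS *.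
    exists [set v; u]; last by rewrite /starsub imset_set1.
    by apply/imsetP; exists (v, u); rewrite // inE; rewrite sub1set inE in sS.
  case=> e /imsetP[[v u]]; rewrite inE /= => vu -> ->.
  exists v, [set u]; rewrite sub1set inE vu cards1; split=> //.
  by rewrite /starsub imset_set1.
by rewrite card_imset // => x y [].
Qed.

Lemma handshake : \sum_(v : G) deg v = 2 * #|edges G|.
Proof.
transitivity (\sum_(p : G * G | adj p.1 p.2) 1).
  rewrite (eq_bigl (fun p : G * G => true && adj p.1 p.2)) //.
  rewrite -(pair_big_dep xpredT (fun v u => adj v u) (fun _ _ => 1)) /=.
  by apply: eq_bigr => v _; rewrite sum1_card /deg cardsE.
rewrite (partition_big (fun p : G * G => [set p.1; p.2]) (mem (edges G))) /=;
  last by move=> p ap; apply/imsetP; exists p; rewrite ?inE.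
rewrite mulnC -sum_nat_const.
apply: eq_bigr => e /imsetP[[v u]]; rewrite inE /= => vu ->.
have nvu : v != u by apply: contraTneq vu => ->; rewrite adj_irrefl.
rewrite sum1dep_card -(_ : #|[set (v, u); (u, v)]| = 2).
  congr #|pred_of_set _|; apply/setP=> -[x y]; rewrite !inE !xpair_eqE /=.
  apply/andP/orP=> [[xy E]|].
    have nxy : x != y by apply: contraTneq xy => ->; rewrite adj_irrefl.
    have : x \in [set v; u] by rewrite -(eqP E) !inE eqxx.
    have : y \in [set v; u] by rewrite -(eqP E) !inE eqxx orbT.
    rewrite !inE => /orP[]/eqP ey /orP[]/eqP ex; rewrite ex ey !eqxx //= in nxy *.
    - by right.
    - by left.
  by case=> /andP[/eqP-> /eqP->]; rewrite ?vu //; rewrite adj_sym vu setUC.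
by rewrite cards2 xpair_eqE (negbTE nvu).
Qed.

End StarCount.

(* Main.v *)
(* The vertices of G_n^l(i) have degrees n - 1, i + l and n - 1 - i, so s_t (or
   2 s_1 when t = 1) is an explicit combination of three binomials.  If
   t >= (n + l + 1) / 2, only the vertices of full degree centre a t-star of
   G_n^l(i_0), and both sides are compared through
   (n - 1) C(n - 2, t) = (n - 1 - t) C(n - 1, t).  If l = 0 and t <= n / 2, the
   same identity reduces the claim to r(t) < g(t) C(n - 1, t), with g affine and
   r a combination of C(i_0, t) and C(n - 1 - i_0, t).  This follows by induction
   on t from the case t = 1, because (t + 1) r(t + 1) <= u r(t) and
   u g(t) <= (n - 1 - t) g(t + 1), where u = n - 1 - i_0 - t.  The case t = 1
   fails for n <= 5, where the inequality is checked by computation. *)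
Require Import Defs.
From mathcomp Require Import all_boot all_order all_algebra.
From mathcomp Require Import zify.

Import Order.TTheory GRing.Theory Num.Theory.

(** The part orders are naturals here, so the counting never meets the absolute values in [Gnl]. *)
Definition join3 a i c : sgraph :=
  gjoin (complete a) (gunion (edgeless i) (complete c)).

Definition star_sum t a i c : nat :=
  a * 'C((a + i + c).-1, t) + (i * 'C(a, t) + c * 'C((a + c).-1, t)).

Lemma degE (G : sgraph) (v : G) : deg v = \sum_(u : G) adj v u.
Proof. by rewrite /deg -sum1dep_card big_mkcond. Qed.

Lemma deg_complete m (v : complete m) : deg v = m.-1.
Proof.
rewrite /deg -[RHS](card_ord m.-1); case: m v => [[]//|m] v.
have -> : nbh v = [set~ (v : 'I_m.+1)].
  by apply/setP=> u; rewrite !inE /= /complete_adj eq_sym.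
by rewrite cardsC1 !card_ord.
Qed.

Lemma deg_edgeless m (v : edgeless m) : deg v = 0.
Proof. by rewrite degE big1. Qed.

Lemma deg_join_l (A B : sgraph) (v : A) :
  deg (inl v : gjoin A B) = deg v + #|B|.
Proof. by rewrite !degE big_sumType /= sum1_card. Qed.

Lemma deg_join_r (A B : sgraph) (v : B) :
  deg (inr v : gjoin A B) = #|A| + deg v.
Proof. by rewrite !degE big_sumType /= sum1_card. Qed.

Lemma deg_union_l (A B : sgraph) (v : A) : deg (inl v : gunion A B) = deg v.
Proof. by rewrite !degE big_sumType /= [X in _ + X]big1 ?addn0. Qed.

Lemma deg_union_r (A B : sgraph) (v : B) : deg (inr v : gunion A B) = deg v.
Proof. by rewrite !degE big_sumType /= [X in X + _]big1. Qed.

Lemma sum_bin_deg_join3 t a i c :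
  \sum_(v : join3 a i c) 'C(deg v, t) = star_sum t a i c.
Proof.
rewrite /join3 big_sumType /=.
rewrite (eq_bigr (fun=> 'C((a + i + c).-1, t))); last first.
  move=> v _; rewrite deg_join_l deg_complete card_sum !card_ord.
  by congr 'C(_, _); have := ltn_ord v; lia.
rewrite sum_nat_const card_ord big_sumType /=.
rewrite (eq_bigr (fun=> 'C(a, t))); last first.
  by move=> v _; rewrite deg_join_r deg_union_l deg_edgeless card_ord addn0.
rewrite sum_nat_const card_ord (eq_bigr (fun=> 'C((a + c).-1, t))); last first.
  move=> v _; rewrite deg_join_r deg_union_r deg_complete card_ord.
  by congr 'C(_, _); have := ltn_ord v; lia.
by rewrite sum_nat_const card_ord.
Qed.

(** For [t = 1] the degree sum counts each edge twice; the same factor on both sides cancels in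
    comparisons. *)
Lemma stars_join3 t a i c : 0 < t ->
  (t == 1).+1 * stars t (join3 a i c) = star_sum t a i c.
Proof.
rewrite -sum_bin_deg_join3; case: eqP => [-> _|t1 t0].
  by rewrite stars1 -handshake; apply: eq_bigr => v _; rewrite bin1.
by rewrite mul1n stars_gt1 //; lia.
Qed.

Lemma leq_stars t a i c a' i' c' : 0 < t ->
  (stars t (join3 a i c) <= stars t (join3 a' i' c')) =
  (star_sum t a i c <= star_sum t a' i' c').
Proof. by move=> t0; rewrite -!stars_join3 // leq_pmul2l. Qed.

Lemma ltn_stars t a i c a' i' c' : 0 < t ->
  (stars t (join3 a i c) < stars t (join3 a' i' c')) =
  (star_sum t a i c < star_sum t a' i' c').
Proof. by move=> t0; rewrite -!stars_join3 // ltn_pmul2l. Qed.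

(* [L = l + 1], [k = i_0 - 1] and [d] is the parity of [n - 1 - l]; the shifts
   keep every subtraction out of the statement. *)
Lemma large_stars k L d t (n := 2 * k + 2 + L + d) :
    k.+1 + L + d <= t < n ->
  star_sum t L 1 (2 * k + 1 + d) <= star_sum t (k + L) k.+1 d.+1 /\
  (0 < k -> 0 < L ->
    star_sum t L 1 (2 * k + 1 + d) < star_sum t (k + L) k.+1 d.+1).
Proof.
rewrite {}/n => /andP[t_ge t_lt]; rewrite /star_sum.
have -> : (L + 1 + (2 * k + 1 + d)).-1 = (2 * k + L + d).+1 by lia.
have -> : (k + L + k.+1 + d.+1).-1 = (2 * k + L + d).+1 by lia.
have -> : (L + (2 * k + 1 + d)).-1 = 2 * k + L + d by lia.
have -> : (k + L + d.+1).-1 = k + L + d by lia.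
rewrite (@bin_small L) ?(@bin_small (k + L)) ?(@bin_small (k + L + d)); try lia.
have := mul_bin_down (2 * k + L + d).+1 t.
have : 0 < 'C((2 * k + L + d).+1, t) by rewrite bin_gt0; lia.
move: 'C(_.+1, t) 'C(2 * k + L + d, t) => X Y X_gt0 XY.
(* The lower bound on [t] makes the factor [(2 * k + L + d).+1 - t] at most [k]. *)
have Y_le : (2 * k + L + d).+1 * Y <= k * X by rewrite [leqLHS]XY leq_mul2r; lia.
split=> [|k_gt0 L_gt0].
  by rewrite !muln0; nia.
have kX_gt0 : 0 < k * X by rewrite muln_gt0 k_gt0.
(* If [Y = 0], strictness comes from [kX_gt0]; otherwise from [2 * k + 1 + d < (2 * k + L + d).+1],
   as [0 < L]. *)
by case: Y {XY} Y_le => [|Y] Y_le; rewrite !muln0; nia.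
Qed.

(** Weakening [m - t] to [K - t] lets binomials with different [m] share one factor. *)
Lemma mul_bin_succ_le m t K : m <= K ->
  t.+1 * 'C(m, t.+1) <= (K - t) * 'C(m, t).
Proof. by move=> mK; rewrite mul_bin_left leq_mul2r leq_sub2r ?orbT. Qed.

(* Here [k = i_0], [2 * k + d = n - 1] and [u = k + d - t]. *)
Lemma small_bin_lt k d t u : d <= 1 -> 1 < k -> 2 < k + d ->
  0 < t -> t + u = k + d ->
  (2 * k + d) * (k * 'C(k, t) + d.+1 * 'C(k + d, t)) <
  ((2 * k + d).-1 * u + (k + d)) * 'C(2 * k + d, t).
Proof.
move=> d_le1 k_gt1 kd_gt2; elim: t u => [//|[|t] IHt] u _ tu.
  (* For [t = 1], cancelling [2 * k + d] leaves [3k < k^2 + 1] if [d = 0] and [k + 1 < k^2] if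
     [d = 1]. *)
  by rewrite !bin1; clear IHt; case: d d_le1 kd_gt2 tu => [|[|//]] *; nia.
have {IHt} := IHt u.+1 isT; rewrite addnS -addSn => /(_ tu).
have := @mul_bin_succ_le k t.+1 (k + d) (leq_addr _ _).
have := @mul_bin_succ_le (k + d) t.+1 (k + d) (leqnn _).
have := mul_bin_left (2 * k + d) t.+1.
have -> : k + d - t.+1 = u.+1 by lia.
have -> : 2 * k + d - t.+1 = u.+1 + k by lia.
move: 'C(k, t.+1) 'C(k, t.+2) 'C(k + d, t.+1) 'C(k + d, t.+2).
move: 'C(2 * k + d, t.+1) 'C(2 * k + d, t.+2).
move=> X X' A A' B B' eX eB eA IH.
set N := 2 * k + d in eX IH *.
set r := k * A + d.+1 * B in IH.
set r' := k * A' + d.+1 * B'.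
have r_step : t.+2 * r' <= u.+1 * r.
  rewrite /r /r' 2!mulnDr 2!(mulnCA _ k) 2!(mulnCA _ d.+1).
  by rewrite leq_add // leq_mul2l ?eA ?eB ?orbT.
(* Expanded, this is [N.-1 * u.+1 <= N.-1 * u * k + (k + d) * k], which splits into the two bounds
   below. *)
have g_step : (N.-1 * u.+1 + (k + d)) * u.+1 <=
              (N.-1 * u + (k + d)) * (u.+1 + k).
  have : N.-1 <= (k + d) * k by rewrite /N; nia.
  have : N.-1 * u <= N.-1 * u * k by rewrite leq_pmulr //; lia.
  by move: N.-1 => M; lia.
rewrite -(ltn_pmul2l (ltn0Sn t.+1)).
apply: (@leq_ltn_trans (N * (u.+1 * r))).
  by rewrite mulnCA leq_mul2l r_step orbT.
apply: (@leq_trans (u.+1 * ((N.-1 * u.+1 + (k + d)) * X))).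
  by rewrite mulnCA ltn_pmul2l.
rewrite [leqRHS]mulnCA eX mulnA [leqRHS]mulnA leq_mul2r.
by rewrite mulnC g_step orbT.
Qed.

(** With [N = 2 * k + d] and [u = k + d - t], multiplying by [N] leaves ['C(N, t)] with the
    coefficient [N + N.-1 * (u + k) - N * k = N.-1 * u + (k + d)] of [small_bin_lt]. *)
Lemma small_stars k d t : d <= 1 -> 1 < k -> 2 < k + d -> 0 < t <= k + d ->
  star_sum t k k d.+1 < star_sum t 1 1 (2 * k + d).-1.
Proof.
move=> d_le1 k_gt1 kd_gt2 /andP[t_gt0 t_le]; rewrite /star_sum.
have := @small_bin_lt k d t (k + d - t) d_le1 k_gt1 kd_gt2 t_gt0 (subnKC t_le).
have -> : (k + k + d.+1).-1 = 2 * k + d by lia.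
have -> : (k + d.+1).-1 = k + d by lia.
have -> : (1 + 1 + (2 * k + d).-1).-1 = 2 * k + d by lia.
have -> : (1 + (2 * k + d).-1).-1 = (2 * k + d).-1 by lia.
have := mul_bin_down (2 * k + d) t.
have -> : 2 * k + d - t = k + d - t + k by lia.
move: 'C(1, t) 'C(k, t) 'C(k + d, t) 'C(2 * k + d, t) 'C(_, t) (k + d - t).
move=> Z A B X Y u eY lt_r.
rewrite -(@ltn_pmul2l (2 * k + d)); last by lia.
have := congr1 (muln (2 * k + d).-1) eY.
case: k k_gt1 {kd_gt2 t_le} lt_r eY => // k _ lt_r eY.
have -> : (2 * k.+1 + d).-1 = (2 * k + d).+1 by lia.
nia.
Qed.

Lemma Gnl_join3 n (l : int) i a c : (i%:Z + l = a%:Z)%R ->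
  (n%:Z - 2%:Z * i%:Z - l = c%:Z)%R -> Gnl n l i = join3 a i c.
Proof. by rewrite /Gnl => -> ->. Qed.

Lemma half_le_nat (z : int) (t : nat) :
  (z%:~R / 2 <= t%:R :> rat)%R = (z <= t%:Z * 2)%R.
Proof.
rewrite ler_pdivrMr //.
have -> : (t%:R * 2 = (t%:Z * 2)%:~R :> rat)%R by rewrite intrM.
by rewrite ler_int.
Qed.

Theorem theorem9 (n t : nat) (t_ge1 : 1 <= t) (t_le : t <= n - 1) :
  (4 <= n ->
     ((((n%:R + 1) / 2 <= t%:R :> rat)%R ->
         stars t (Gnl n 0%Z 1) <= stars t (Gnl n 0%Z (i0 n 0%Z)) /\
         (6 <= n -> stars t (Gnl n 0%Z 1) < stars t (Gnl n 0%Z (i0 n 0%Z)))) /\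
      ((t%:R < (n%:R + 1) / 2 :> rat)%R ->
         stars t (Gnl n 0%Z (i0 n 0%Z)) <= stars t (Gnl n 0%Z 1) /\
         (6 <= n -> stars t (Gnl n 0%Z (i0 n 0%Z)) < stars t (Gnl n 0%Z 1)))))
  /\
  (forall l : int, (-1 <= l)%R -> (l <= n%:Z - 3)%R ->
     ((n%:R + l%:~R + 1) / 2 <= t%:R :> rat)%R ->
     stars t (Gnl n l 1) <= stars t (Gnl n l (i0 n l)) /\
     ((0 <= l)%R -> (l <= n%:Z - 5)%R ->
        stars t (Gnl n l 1) < stars t (Gnl n l (i0 n l)))).
Proof.
have large l : (-1 <= l)%R -> (l <= n%:Z - 3)%R ->
    ((n%:R + l%:~R + 1) / 2 <= t%:R :> rat)%R ->
    stars t (Gnl n l 1) <= stars t (Gnl n l (i0 n l)) /\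
    ((0 <= l)%R -> (l <= n%:Z - 5)%R ->
       stars t (Gnl n l 1) < stars t (Gnl n l (i0 n l))).
  move=> l_ge l_le.
  have -> : (n%:R + l%:~R + 1 = (n%:Z + l + 1)%:~R :> rat)%R by rewrite !intrD.
  rewrite half_le_nat => t_ge.
  have [k [L [d [d_le1 lE nE i0E]]]] : exists k L d : nat,
      [/\ d <= 1, l = (L%:Z - 1)%R, n = 2 * k + 2 + L + d & i0 n l = k.+1].
    (* The predecessor is exact: [l <= n - 3] gives [i0 n l >= 1]. *)
    exists (i0 n l).-1, `|(l + 1)%R|, `|(n%:Z - 1 - l - 2 * (i0 n l)%:Z)%R|.
    by rewrite /i0; split; lia.
  rewrite i0E (@Gnl_join3 n l 1 L (2 * k + 1 + d)); try lia.
  rewrite (@Gnl_join3 n l k.+1 (k + L) d.+1); try lia.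
  rewrite leq_stars // ltn_stars //.
  have [|le_s lt_s] := @large_stars k L d t; first by lia.
  by split=> // l0 l5; apply: lt_s; lia.
split=> // n_ge4; split=> [t_ge|].
  have [|||le_s lt_s] := large 0%R _ _ _; [lia|lia|by rewrite addr0|].
  by split=> // n_ge6; apply: lt_s; lia.
have -> : (n%:R + 1 = (n%:Z + 1)%:~R :> rat)%R by rewrite intrD.
rewrite ltNge half_le_nat => t_lt.
have [k [d [d_le1 k_gt0 nE i0E]]] : exists k d : nat,
    [/\ d <= 1, 0 < k, n = 2 * k + d + 1 & i0 n 0 = k].
  exists (i0 n 0), `|(n%:Z - 1 - 2 * (i0 n 0)%:Z)%R|.
  by rewrite /i0; split; lia.
rewrite i0E (@Gnl_join3 n 0 1 1 (2 * k + d).-1); try lia.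
rewrite (@Gnl_join3 n 0 k k d.+1); try lia.
rewrite leq_stars // ltn_stars //.
have t_lek : t <= k + d by lia.
have [k_big|k_small] := boolP ((1 < k) && (2 < k + d)).
  have {}lt_s := @small_stars k d t d_le1 _ _ _.
  by split=> [|_]; [apply: ltnW|]; apply: lt_s; lia.
(* Only [n = 4] and [n = 5] remain, so strictness is vacuous, and [t <= k + d = 2]. *)
split; last by lia.
have [[-> ->]|[-> ->]] : (k = 1 /\ d = 1) \/ (k = 2 /\ d = 0) by lia.
  by have [->|->] : t = 1 \/ t = 2 by lia.
by have [->|->] : t = 1 \/ t = 2 by lia.
Qed.
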